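(* Let $z>0$ and let $(a_n)_{n\ge1}$, $(b_n)_{n\ge0}$ be the three-term recurrence coefficients of the monic orthogonal polynomials with respect to $\langle \mathbf{u}_z,p\rangle=\int_0^\infty p(x)e^{-zx^4}\,dx$. Put $R_n=a_{n+1}+b_n^2+a_n$ and $T_n=a_n(b_n+b_{n-1})$. Then, for all $n\ge 0$, $$4z\left[a_{n+2}a_{n+1}+T_{n+1}(b_{n+1}+b_n)+R_n^2+T_n(b_n+b_{n-1})+a_na_{n-1}\right]=2n+1,$$ $$4z\left[a_{n+1}(T_{n+2}+T_n)-a_n(T_{n+1}+T_{n-1})-T_n(R_n+R_{n-1})+T_{n+1}(R_{n+1}+R_n)\right]=b_n.$$
   Context: The functional $\mathbf{u}_z$ is positive definite; $(P_n)_{n\ge0}$ denotes its sequence of monic orthogonal polynomials ($\deg P_n=n$, $\langle\mathbf{u}_z,P_nP_m\rangle=0$ for $n\ne m$). The coefficients $a_n\neq0$ ($n\ge1$) and $b_n$ ($n\ge0$) are defined by $xP_n(x)=P_{n+1}(x)+b_nP_n(x)+a_nP_{n-1}(x)$, $n\ge0$, with $P_{-1}=0$, $P_0=1$. Convention: $a_k=0$ for $k\le 0$ and $b_k=0$ for $k<0$, so that $T_k=0$ for $k\le0$. *)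

(* Defs.v *)
From HB Require Import structures.
From mathcomp Require Import all_boot all_order all_algebra.
From mathcomp Require Import all_classical all_reals all_analysis.

Set Implicit Arguments.
Unset Strict Implicit.
Unset Printing Implicit Defensive.

Import Order.TTheory GRing.Theory Num.Theory.
Import numFieldNormedType.Exports.

Local Open Scope classical_set_scope.
Local Open Scope ring_scope.

(* The integrand is absolutely integrable for z > 0, so this Lebesgue integral
   is the (improper) integral of p(x) exp(-z x^4) over [0, +oo). *)
Definition quartic_functional (R : realType) (z : R) (p : {poly R}) : R :=
  \int[@lebesgue_measure R]_(x in `[0, +oo[) (p.[x] * expR (- (z * x ^+ 4))).

Definition monic_orthogonal_polys (R : realType) (u : {poly R} -> R)
    (P : nat -> {poly R}) : Prop :=
  [/\ forall n : nat, P n \is monic,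
      forall n : nat, size (P n) = n.+1
    & forall n m : nat, n <> m -> u (P n * P m) = 0].

(* The coefficients are indexed by int, so that the conventions a_k = 0 for
   k <= 0 and b_k = 0 for k < 0 give a meaning to a_{n-1}, b_{n-1}, R_{n-1},
   T_{n-1} for every n >= 0.  The match encodes P_{-1} = 0. *)
Definition recurrence_coefs (R : realType) (P : nat -> {poly R})
    (a b : int -> R) : Prop :=
  [/\ forall k : int, k <= 0 -> a k = 0,
      forall k : int, k < 0 -> b k = 0
    & forall n : nat,
        'X * P n = P n.+1 + b n%:Z *: P n
                   + a n%:Z *: (if n is m.+1 then P m else 0)].

Definition Rcoef (R : realType) (a b : int -> R) (n : int) : R :=
  a (n + 1) + b n ^+ 2 + a n.

Definition Tcoef (R : realType) (a b : int -> R) (n : int) : R :=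
  a n * (b n + b (n - 1)).

(* Main.v *)
(* Integrating (x q(x) exp(-z x^4))' over [0, +oo[ gives the Pearson identity
   u((x q)') = 4 z u(x^4 q) for every polynomial q, since the boundary terms
   vanish.  For q = P_n^2 the left-hand side is (2n+1) u(P_n^2), because
   x P_n' has leading coefficient n; expanding x^2 P_n in P_{n-2}, ..., P_{n+2}
   and using a_m u(P_{m-1}^2) = u(P_m^2) turns the right-hand side into the first
   bracket times 4 z u(P_n^2).  For q = P_{n+1} P_n the left-hand side is
   -s_{n+1} u(P_n^2), with s_n the coefficient of x^{n-1} in P_n; the second
   identity is the difference of two consecutive such relations, since
   s_n - s_{n+1} = b_n. *)
Require Import Defs.
From HB Require Import structures.
From mathcomp Require Import all_boot all_order all_algebra.
From mathcomp Require Import all_classical all_reals all_analysis.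
From mathcomp Require Import measurable_realfun.
From mathcomp Require Import ring lra zify.

Set Implicit Arguments.
Unset Strict Implicit.
Unset Printing Implicit Defensive.

Import Order.TTheory GRing.Theory Num.Theory.
Import numFieldNormedType.Exports.

Local Open Scope classical_set_scope.
Local Open Scope ring_scope.

(** * Analysis of the weight: decay, integrability, boundary terms, definiteness *)

Lemma finite_roots (R : idomainType) (p : {poly R}) :
  p != 0 -> finite_set [set x | root p x].
Proof.
move: {2}(size p) (leqnn (size p)) => n; elim: n p => [|n IH] p sp p0.
  by move: sp; rewrite leqn0 size_poly_eq0 (negbTE p0).
have [[x px]|no_root] := pselect (exists x, root p x); last first.
  rewrite (_ : [set x | _] = set0); first exact: finite_set0.
  by apply/seteqP; split => // x px; apply: no_root; exists x.
move/factor_theorem: (px) => [q pq]; have q0 : q != 0.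
  by apply: contraNneq p0 => q0; rewrite pq q0 mul0r.
have sq : (size q <= n)%N.
  by move: sp; rewrite pq size_mul ?polyXsubC_eq0// size_XsubC addn2.
rewrite (_ : [set y | _] = [set y | root q y] `|` [set x]).
  by rewrite finite_setU; split; [exact: IH|exact: finite_set1].
apply/seteqP; split => y /=; rewrite pq rootM root_XsubC.
  by case/orP => [->|/eqP ->]; [left|right].
by case=> [->//|->]; rewrite eqxx orbT.
Qed.

Section QuarticWeight.
Variables (R : realType) (z : R).
Hypothesis z_gt0 : 0 < z.

Local Notation mu := (@lebesgue_measure R).
Local Notation w := (fun x : R => expR (- (z * x ^+ 4))).

(** By induction on the Horner form: as [x <= expR x], each factor [x] raises the exponent [N] by
    one, and a constant is dominated because the exponent stays nonnegative. *)
Lemma horner_le_expR (p : {poly R}) : exists c N : R,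
  [/\ 0 <= c, 0 <= N & forall x, 0 <= x -> `|p.[x]| <= c * expR (N * x)].
Proof.
elim/poly_ind: p => [|p c [d [N [d0 N0 hd]]]].
  by exists 0, 0; split => // x _; rewrite horner0 normr0 mul0r.
exists (d + `|c|), (N + 1); split; [by rewrite addr_ge0| by rewrite addr_ge0|].
move=> x x0; rewrite hornerMXaddC (le_trans (ler_normD _ _))// mulrDl lerD//.
  rewrite normrM mulrDl mul1r expRD mulrA ler_pM// ?hd// ger0_norm//.
  by rewrite (le_trans _ (expR_ge1Dx x))// lerDr.
rewrite ler_peMr// -[leLHS]expR0 ler_expR mulr_ge0// addr_ge0//.
Qed.

(* The tangent line of [x^4] at [t = 1 + N/z] has slope at least [N/z]. *)
Lemma quartic_ge_linear (N : R) : 0 <= N ->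
  exists M, forall x, 0 <= x -> N * x - z * x ^+ 4 <= M.
Proof.
move=> N0; pose t := 1 + N / z.
have t1 : 1 <= t by rewrite lerDl divr_ge0// ltW.
have zt : N <= z * t by rewrite mulrDr mulr1 mulrCA divff ?gt_eqF// mulr1 lerDr ltW.
have tangent x : 4 * t ^+ 3 * x - 3 * t ^+ 4 <= x ^+ 4.
  rewrite -subr_ge0.
  (* Tangency gives a double root at [t]; the cofactor is a sum of squares. *)
  have -> : x ^+ 4 - (4 * t ^+ 3 * x - 3 * t ^+ 4)
    = (x - t) ^+ 2 * ((x + t) ^+ 2 + 2 * t ^+ 2) by ring.
  by rewrite mulr_ge0 ?sqr_ge0// addr_ge0 ?sqr_ge0// mulr_ge0// sqr_ge0.
exists (z * (3 * t ^+ 4)) => x x0; rewrite lerBlDr -lerBlDl.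
have slope : N * x <= z * (4 * t ^+ 3 * x).
  rewrite (mulrA z) ler_wpM2r//; apply: (le_trans zt).
  rewrite ler_pM2l//.
  have : t ^+ 1 <= t ^+ 3 by rewrite ler_weXn2l.
  have : 0 <= t ^+ 3 by rewrite exprn_ge0// (le_trans ler01).
  by rewrite expr1; lra.
apply: (@le_trans _ _ (z * (4 * t ^+ 3 * x - 3 * t ^+ 4))).
  by rewrite mulrBr lerB.
by rewrite -subr_ge0 -mulrBr mulr_ge0 ?(ltW z_gt0)// subr_ge0.
Qed.

(** This single bound serves for integrability, for the limit at infinity and for the sign condition
    in the fundamental theorem. Using the quartic estimate with [N + 1] in place of [N] leaves the
    factor [expR (- x)]. *)
Lemma poly_weight_le_expRN (p : {poly R}) : exists2 c, 0 <= c &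
  forall x, 0 <= x -> `|p.[x] * w x| <= c * expR (- x).
Proof.
have [c [N [c0 N0 hc]]] := horner_le_expR p.
have [M hM] := quartic_ge_linear (addr_ge0 N0 ler01).
exists (c * expR M) => [|x x0]; first by rewrite mulr_ge0// expR_ge0.
rewrite normrM [`|expR _|]ger0_norm ?expR_ge0//.
apply: (le_trans (ler_wpM2r (expR_ge0 _) (hc x x0))).
rewrite -!mulrA ler_wpM2l// -!expRD ler_expR.
by have := hM x x0; lra.
Qed.

Lemma is_derive_poly_weight (p : {poly R}) (x : R) :
  is_derive x (1 : R) (fun x => p.[x] * w x)
    ((p^`() - (4 * z) *: ('X^3 * p)).[x] * w x).
Proof.
pose q : {poly R} := - (z *: 'X^4).
have -> : (fun x => p.[x] * w x) = (horner p * (expR \o horner q)).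
  by apply/funext => y; rewrite [RHS]/GRing.mul/= /q !hornerE.
have dw := is_derive1_comp (is_derive_expR q.[x]) (is_derive_poly q x).
apply: (is_derive_eq (is_deriveM (is_derive_poly p x) dw)).
rewrite /GRing.scale/= /q derivN derivZ derivXn -scaler_nat !hornerE/=.
by ring.
Qed.

Lemma continuous_poly_weight (p : {poly R}) :
  continuous (fun x => p.[x] * w x).
Proof.
move=> x; apply: differentiable_continuous; apply/derivable1_diffP.
by have [] := is_derive_poly_weight p x.
Qed.

Lemma cvg_poly_weight_pinfty (p : {poly R}) : p.[x] * w x @[x --> +oo] --> 0.
Proof.
have [c c0 hc] := poly_weight_le_expRN p.
have cvgc : c * expR (- x) @[x --> +oo] --> 0.
  by rewrite -(mulr0 c); apply: cvgM; [exact: cvg_cst|exact: cvgr_expR].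
apply: (squeeze_cvgr _ _ cvgc); last by rewrite -oppr0; exact: (cvgN cvgc).
by near=> x; rewrite -ler_norml hc.
Unshelve. all: by end_near. Qed.

Lemma integral_expRN :
  (\int[mu]_(x in `[0%R, +oo[) (expR (- x))%:E = 1%:E)%E.
Proof.
rewrite (@ge0_continuous_FTC2y _ _ (fun x => - expR (- x)) _ 0).
- by rewrite oppr0 expR0 EFinN oppeK add0e.
- by move=> x _; exact: expR_ge0.
- apply: continuous_subspaceT => x; apply: continuous_comp.
    exact: continuousN.
  exact: continuous_expR.
- by rewrite -oppr0; exact: (cvgN (@cvgr_expR R)).
- by move=> x _; exact: ex_derive.
- apply: cvg_at_right_filter; apply: cvgN; apply: continuous_comp.
    exact: continuousN.
  exact: continuous_expR.
- by move=> x _; rewrite derive1E derive_val /GRing.scale/=; ring.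
Qed.

Lemma integrable_expRN :
  mu.-integrable `[0, +oo[ (fun x : R => (expR (- x))%:E).
Proof.
apply/integrableP; split.
  apply/measurable_EFinP; apply: measurable_funTS.
  apply: continuous_measurable_fun => x.
  by apply: continuous_comp; [exact: continuousN|exact: continuous_expR].
under eq_integral do rewrite gee0_abs ?lee_fin ?expR_ge0//.
by rewrite integral_expRN ltry.
Qed.

Lemma integrable_scaled_expRN (c : R) :
  mu.-integrable `[0, +oo[ (EFin \o (fun x : R => c * expR (- x))).
Proof. by apply: (integrableZl _ c integrable_expRN). Qed.

Lemma integrable_poly_weight (p : {poly R}) :
  mu.-integrable `[0, +oo[ (EFin \o (fun x => p.[x] * w x)).
Proof.
have [c c0 hc] := poly_weight_le_expRN p.
apply: le_integrable (integrable_scaled_expRN c) => //.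
- apply/measurable_EFinP; apply: measurable_funTS.
  apply: continuous_measurable_fun.
  exact: continuous_poly_weight.
- move=> x; rewrite /= in_itv/= andbT => x0.
  by rewrite lee_fin [leRHS]ger0_norm ?hc// mulr_ge0// expR_ge0.
Qed.

(* Adding a large multiple of [exp(-x)] makes the derivative of [p w]
   nonnegative, so that the fundamental theorem on [0, +oo[ applies. *)
Lemma integral_deriv_poly_weight (p : {poly R}) :
  quartic_functional z (p^`() - (4 * z) *: ('X^3 * p)) = - p.[0].
Proof.
set q := _ - _.
have [c c0 hc] := poly_weight_le_expRN q.
pose e (x : R) := c * expR (- x).
have int_e : mu.-integrable `[0, +oo[ (EFin \o e) := integrable_scaled_expRN c.
have Re : \int[mu]_(x in `[0, +oo[) e x = c.
  rewrite RintegralZl//; last exact: integrable_expRN.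
  by rewrite /Rintegral integral_expRN/= mulr1.
have cexp : continuous (fun x : R => expR (- x)).
  by move=> x; apply: continuous_comp; [exact: continuousN|exact: continuous_expR].
have ce : continuous e.
  by move=> x; apply: cvgM; [exact: cvg_cst|exact: cexp].
have dF x : is_derive x (1 : R) (fun x => p.[x] * w x - e x) (q.[x] * w x + e x).
  have dp := is_derive_poly_weight p x.
  have de : is_derive x (1 : R) e (- e x).
    by apply: is_derive_eq; rewrite /GRing.scale/= /e; ring.
  by apply: is_derive_eq; rewrite opprK.
(* The antiderivative [p w - e] goes from [p.[0] - c] at 0 to 0 at infinity; the integral [c] of [e]
   is removed afterwards. *)
have : \int[mu]_(x in `[0, +oo[) (q.[x] * w x + e x) = c - p.[0].
  rewrite (@Rintegral_ge0_continuous_FTC2y _ _ (fun x => p.[x] * w x - e x) _ 0).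
  - by rewrite /e expr0n/= mulr0 oppr0 expR0; ring.
  - by move=> x /hc; rewrite ler_norml => /andP[+ _]; rewrite /e; lra.
  - apply: continuous_subspaceT => x.
    by apply: cvgD; [exact: continuous_poly_weight|exact: ce].
  - rewrite -(subr0 0); apply: cvgB; first exact: cvg_poly_weight_pinfty.
    by rewrite -(mulr0 c); apply: cvgM; [exact: cvg_cst|exact: cvgr_expR].
  - by move=> x _; have [] := dF x.
  - apply: cvg_at_right_filter.
    by apply: cvgB; [exact: continuous_poly_weight|exact: ce].
  - by move=> x _; rewrite derive1E derive_val.
rewrite RintegralD//; last exact: integrable_poly_weight.
by rewrite Re /quartic_functional; lra.
Qed.

Lemma quartic_functionalD (p q : {poly R}) : quartic_functional z (p + q)
  = quartic_functional z p + quartic_functional z q.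
Proof.
rewrite /quartic_functional -RintegralD//; try exact: integrable_poly_weight.
by apply: eq_Rintegral => x _; rewrite hornerD mulrDl.
Qed.

Lemma quartic_functionalZ (c : R) (p : {poly R}) :
  quartic_functional z (c *: p) = c * quartic_functional z p.
Proof.
rewrite /quartic_functional -RintegralZl//; last exact: integrable_poly_weight.
by apply: eq_Rintegral => x _; rewrite hornerZ -mulrA.
Qed.

(** If the integral of the nonnegative function [p^2 w] were zero, this function would vanish almost
    everywhere. Since [w] has no zeros, the half-line would lie in the union of a null set and the
    finite root set of [p], contradicting its infinite measure. *)
Lemma quartic_functional_sqr_neq0 (p : {poly R}) :
  p != 0 -> quartic_functional z (p * p) != 0.
Proof.
move=> p0; apply/negP => /eqP u0.
pose f x := (p * p).[x] * w x.
have f_ge0 x : 0 <= f x.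
  by rewrite /f hornerM -expr2 mulr_ge0 ?sqr_ge0// expR_ge0.
have int_f : mu.-integrable `[0, +oo[ (EFin \o f) := integrable_poly_weight _.
have : (\int[mu]_(x in `[0%R, +oo[) `|(EFin \o f) x| = 0)%E.
  under eq_integral do rewrite /= ger0_norm//.
  rewrite -[LHS]fineK; last exact: (integrable_fin_num _ int_f).
  by congr EFin; exact: u0.
have [mf _] := integrableP _ _ _ int_f.
case/(ae_eq_integral_abs mu (measurable_itv _) mf).1.
move=> N [mN N0 subN].
have roots0 : mu [set x | root p x] = 0%E.
  exact/countable_lebesgue_measure0/finite_set_countable/finite_roots.
have mroots : measurable [set x : R | root p x].
  by apply: countable_measurable => //; exact/finite_set_countable/finite_roots.
have : mu (`[0%R, +oo[ : set R) = 0%E.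
  apply: (subset_measure0 (B := N `|` [set x | root p x])) => //.
  - exact: measurableU.
  - move=> x x_ge0; have [px|px] := boolP (root p x); [by right|left].
    apply: subN => /= /(_ x_ge0) -[] /eqP.
    by rewrite /f mulf_eq0 expR_eq0 orbF hornerM mulf_eq0 orbb; exact/negP.
  - exact: null_set_setU.
by rewrite lebesgue_measure_itv /= ltry.
Qed.

End QuarticWeight.

(** * Orthogonality and leading coefficients for an abstract linear functional *)

Section OrthogonalPolynomials.
Variables (R : realType) (u : {poly R} -> R) (P : nat -> {poly R}).
Hypothesis uD : forall p q, u (p + q) = u p + u q.
Hypothesis uZ : forall c p, u (c *: p) = c * u p.
Hypothesis P_orth : monic_orthogonal_polys u P.

Let u0 : u 0 = 0.
Proof. by rewrite -(scale0r 0) uZ mul0r. Qed.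

(** A Parseval formula. The [h i] may be zero, so the family may include the zero polynomials that
    stand for negative indices. *)
Lemma functional_dot (I : finType) (Q : I -> {poly R}) (h c d : I -> R) :
  (forall i j, u (Q i * Q j) = if i == j then h i else 0) ->
  u ((\sum_i c i *: Q i) * (\sum_j d j *: Q j)) = \sum_i c i * d i * h i.
Proof.
move=> Q_orth.
rewrite mulr_suml (big_morph u uD u0); apply: eq_bigr => i _.
rewrite mulr_sumr (big_morph u uD u0) (bigD1 i)//= big1 => [|j ji].
  by rewrite addr0 -scalerAl -scalerAr !uZ Q_orth eqxx mulrA.
by rewrite -scalerAl -scalerAr !uZ Q_orth eq_sym (negbTE ji) !mulr0.
Qed.

Lemma orthogonal_lead_coef (n : nat) : (P n)`_n = 1.
Proof.
have [Pmonic Psize _] := P_orth.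
by have /monicP := Pmonic n; rewrite lead_coefE Psize.
Qed.

Lemma size_sub_lead (n : nat) (q : {poly R}) : (size q <= n.+1)%N ->
  (size (q - q`_n *: P n)%R <= n)%N.
Proof.
have [_ Psize _] := P_orth.
move=> sq; apply/leq_sizeP => j; rewrite leq_eqVlt => /predU1P[<-|nj].
  by rewrite coefB coefZ orthogonal_lead_coef mulr1 subrr.
rewrite coefB coefZ (nth_default 0 (leq_trans sq nj)).
by rewrite [(P n)`_j]nth_default ?Psize// mulr0 subrr.
Qed.

Lemma functional_lower (n : nat) (q : {poly R}) :
  (size q <= n)%N -> u (P n * q) = 0.
Proof.
have [_ _ Porth] := P_orth.
(* The size bound is separated from [n], so that the induction can strip one multiple of [P m] at a
   time while [P n] stays fixed. *)
suff H m : (m <= n)%N -> (size q <= m)%N -> u (P n * q) = 0 by exact: H.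
elim: m q => [|m IH] q mn sq.
  by move: sq; rewrite leqn0 size_poly_eq0 => /eqP ->; rewrite mulr0.
rewrite -[q](subrK (q`_m *: P m)) mulrDr uD IH ?(ltnW mn) ?size_sub_lead//.
by rewrite -scalerAr uZ Porth ?mulr0 ?addr0// => nm; rewrite nm ltnn in mn.
Qed.

Lemma functional_lead (n : nat) (q : {poly R}) : (size q <= n.+1)%N ->
  u (P n * q) = q`_n * u (P n * P n).
Proof.
move=> sq; rewrite -{1}[q](subrK (q`_n *: P n)) mulrDr uD.
by rewrite functional_lower ?size_sub_lead// add0r -scalerAr uZ.
Qed.

Lemma size_mulX_deriv (n : nat) : (size ('X * (P n)^`())%R <= n.+1)%N.
Proof.
have [_ Psize _] := P_orth.
apply/leq_sizeP => j nj; rewrite coefXM; case: j nj => // j nj.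
by rewrite coef_deriv nth_default ?mul0rn// Psize.
Qed.

Lemma functional_mulX_deriv (n : nat) :
  u ('X * (P n)^`() * P n) = n%:R * u (P n * P n).
Proof.
rewrite [X in u X]mulrC (functional_lead (size_mulX_deriv n)); congr (_ * _).
by rewrite coefXM; case: n => // n; rewrite coef_deriv orthogonal_lead_coef.
Qed.

(* [x P_{n+1}' - (n+1) P_{n+1}] has degree at most [n], with leading
   coefficient minus the subleading coefficient of [P_{n+1}]. *)
Lemma functional_mulX_deriv_succ (n : nat) :
  u ('X * (P n.+1)^`() * P n) = - (P n.+1)`_n * u (P n * P n).
Proof.
have [_ Psize Porth] := P_orth.
set q := 'X * _.
have sq : (size (q - n.+1%:R *: P n.+1)%R <= n.+1)%N.
  have <- : q`_n.+1 = n.+1%:R by rewrite coefXM/= coef_deriv orthogonal_lead_coef.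
  by rewrite size_sub_lead// size_mulX_deriv.
rewrite -[q](subrK (n.+1%:R *: P n.+1)) mulrDl uD [_ * P n]mulrC.
rewrite (functional_lead sq) -scalerAl uZ (Porth n.+1 n) ?mulr0 ?addr0; last first.
  by move/eqP; rewrite eqn_leq ltnn.
congr (_ * _); rewrite coefB coefZ coefXM.
case: n {sq Porth Psize} @q => [|n] /= ; first by rewrite mul1r sub0r.
by rewrite coef_deriv -mulr_natl -(natr1 n.+1); ring.
Qed.

(** * The recurrence and the squared norms in shifted indices *)

Variables (a b : int -> R) (z : R).
Hypothesis ab_rec : recurrence_coefs P a b.
Hypothesis pearson : forall q, u (('X * q)^`()) = 4 * z * u ('X^4 * q).
Hypothesis h_neq0 : forall n, u (P n * P n) != 0.

(* [Psh j = P_{j-2}], so that all indices below are natural numbers. *)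
Definition Psh (j : nat) : {poly R} := if j is n.+2 then P n else 0.
Arguments Psh : simpl never.
Definition ash (j : nat) : R := a (j%:Z - 2).
Definition bsh (j : nat) : R := b (j%:Z - 2).

Lemma ash_low (j : nat) : (j <= 2)%N -> ash j = 0.
Proof.
by move=> j2; have [a0 _ _] := ab_rec; rewrite /ash a0// subr_le0 lez_nat.
Qed.

(** The case [j = 0] must be excluded: the left side would be 0 and the right side [P 0]. *)
Lemma recurrence_shift (j : nat) : (0 < j)%N ->
  'X * Psh j.+1 = Psh j.+2 + bsh j.+1 *: Psh j.+1 + ash j.+1 *: Psh j.
Proof.
have [_ _ rec] := ab_rec.
case: j => // n _; rewrite /Psh rec /ash /bsh.
have -> : n.+2%:Z - 2 = n by rewrite -[n.+2]addn2 PoszD addrK.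
by case: n.
Qed.

Definition hsh (j : nat) : R := u (Psh j * Psh j).

Lemma Psh_orth (i j : nat) : i != j -> u (Psh i * Psh j) = 0.
Proof.
have [_ _ Porth] := P_orth.
case: i => [|[|i]]; rewrite /Psh ?mul0r//.
case: j => [|[|j]]; rewrite ?mulr0// => /eqP ij.
by apply: Porth => ji; apply: ij; rewrite ji.
Qed.

(** Two evaluations of [u (x P_n P_{n+1})]: by the leading coefficient of [x P_n], and by the
    recurrence for [x P_{n+1}]. *)
Lemma hsh_rec (j : nat) : (1 < j)%N -> ash j.+1 * hsh j = hsh j.+1.
Proof.
have [_ Psize Porth] := P_orth.
case: j => [|[|n]]// _; rewrite /hsh /=.
have r := @recurrence_shift n.+2 isT; rewrite /Psh in r.
have : u (P n.+1 * ('X * P n)) = u ('X * P n.+1 * P n) by congr u; ring.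
rewrite r functional_lead; last first.
  by rewrite mulrC size_mulX ?Psize// -size_poly_eq0 Psize.
rewrite coefXM/= orthogonal_lead_coef mul1r !mulrDl !uD -!scalerAl !uZ => ->.
rewrite (Porth n.+2) ?(Porth n.+1 n) ?mulr0 ?add0r//.
  by move/eqP; rewrite eqn_leq ltnn.
by move/eqP; rewrite eqn_leq ltnNge leqnSn.
Qed.

(** The extra factor [ash j.+1] extends the norm relation to [j = 1], where both sides vanish
    because [a_0 = 0]. *)
Lemma hsh_rec_sqr (j : nat) : (0 < j)%N ->
  ash j.+1 ^+ 2 * hsh j = ash j.+1 * hsh j.+1.
Proof.
rewrite leq_eqVlt => /predU1P[<-|j1]; first by rewrite ash_low// expr0n !mul0r.
by rewrite expr2 -mulrA hsh_rec.
Qed.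

Lemma mulX2_shift (k : nat) :
  'X^2 * Psh k.+2 = Psh k.+4 + (bsh k.+3 + bsh k.+2) *: Psh k.+3
    + (ash k.+3 + bsh k.+2 ^+ 2 + ash k.+2) *: Psh k.+2
    + (ash k.+2 * (bsh k.+2 + bsh k.+1)) *: Psh k.+1
    + (ash k.+2 * ash k.+1) *: Psh k.
Proof.
(* For [k = 0] the recurrence does not apply to [Psh 1], but the factor [ash 2], which is [a_0],
   vanishes. *)
have low : ash k.+2 *: ('X * Psh k.+1)
    = ash k.+2 *: (Psh k.+2 + bsh k.+1 *: Psh k.+1 + ash k.+1 *: Psh k).
  by case: k => [|k]; [rewrite ash_low// !scale0r|rewrite recurrence_shift].
rewrite expr2 -mulrA recurrence_shift// !mulrDr -!scalerAr low.
rewrite !recurrence_shift// -!mul_polyC !rmorphD !rmorphM/=.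
by ring.
Qed.

Lemma functional_dot5 (k : nat) (c d : 5.-tuple R) :
  u ((\sum_(i < 5) tnth c i *: Psh (k + i)) * (\sum_(i < 5) tnth d i *: Psh (k + i)))
  = \sum_(i < 5) tnth c i * tnth d i * hsh (k + i).
Proof.
apply: functional_dot => i j; case: eqVneq => [->//|ij].
by apply: Psh_orth; rewrite eqn_add2l.
Qed.

Lemma mulX2_sum (k : nat) : 'X^2 * Psh k.+2 = \sum_(i < 5) tnth [tuple
    ash k.+2 * ash k.+1; ash k.+2 * (bsh k.+2 + bsh k.+1);
    ash k.+3 + bsh k.+2 ^+ 2 + ash k.+2; bsh k.+3 + bsh k.+2; 1] i *: Psh (k + i).
Proof.
rewrite mulX2_shift !big_ord_recl big_ord0 !(tnth_nth 0)/= /bump/=.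
by rewrite !addnS addn0 scale1r -!mul_polyC; ring.
Qed.

(** The sum uses the same window [Psh k], ..., [Psh (k + 4)] as [mulX2_sum], so that the two
    expansions pair termwise; the remaining [Psh (k + 5)] is orthogonal to that window. *)
Lemma mulX2_succ_sum (k : nat) : 'X^2 * Psh k.+3 = Psh k.+1.+4 +
  \sum_(i < 5) tnth [tuple 0; ash k.+3 * ash k.+2; ash k.+3 * (bsh k.+3 + bsh k.+2);
    ash k.+4 + bsh k.+3 ^+ 2 + ash k.+3; bsh k.+4 + bsh k.+3] i *: Psh (k + i).
Proof.
rewrite mulX2_shift !big_ord_recl big_ord0 !(tnth_nth 0)/= /bump/=.
by rewrite !addnS addn0 scale0r -!mul_polyC; ring.
Qed.

(** * Quartic moments and the resulting Pearson relations *)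

Lemma quartic_diag (k : nat) : u ('X^4 * (Psh k.+2 * Psh k.+2)) =
  (ash k.+4 * ash k.+3 + ash k.+3 * (bsh k.+3 + bsh k.+2) ^+ 2
   + (ash k.+3 + bsh k.+2 ^+ 2 + ash k.+2) ^+ 2
   + ash k.+2 * (bsh k.+2 + bsh k.+1) ^+ 2 + ash k.+2 * ash k.+1) * hsh k.+2.
Proof.
rewrite (_ : _ * _ = 'X^2 * Psh k.+2 * ('X^2 * Psh k.+2)); last by ring.
rewrite mulX2_sum functional_dot5 !big_ord_recl big_ord0 !(tnth_nth 0)/= /bump/=.
rewrite !addnS addn0 -(hsh_rec (j := k.+3))// -(hsh_rec (j := k.+2))//.
(* Norms of index above [k.+2] are now multiples of [hsh k.+2]. Those below are raised to it by
   their squared coefficients, without division, which also covers the zero polynomials at small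
   [k]. *)
have h1 := hsh_rec_sqr (ltn0Sn k).
have h0 : (ash k.+2 * ash k.+1) ^+ 2 * hsh k = ash k.+2 * ash k.+1 * hsh k.+2.
  case: k h1 => [|k] h1; first by rewrite ash_low// !mul0r expr0n mul0r.
  transitivity (ash k.+3 ^+ 2 * (ash k.+2 ^+ 2 * hsh k.+1)); first by ring.
  by rewrite hsh_rec_sqr// mulrCA h1; ring.
apply: subr0_eq; transitivity
  ((ash k.+2 * ash k.+1) ^+ 2 * hsh k - ash k.+2 * ash k.+1 * hsh k.+2
   + (bsh k.+2 + bsh k.+1) ^+ 2
     * (ash k.+2 ^+ 2 * hsh k.+1 - ash k.+2 * hsh k.+2)); first by ring.
by rewrite h0 h1 !subrr mulr0 addr0.
Qed.

(** In the original indices this is a_{k+1} (T_{k+2} + T_k) + T_{k+1} (R_{k+1} + R_k); its value at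
    [n] minus that at [n - 1] is the second bracket. *)
Definition offdiag_coef (k : nat) : R :=
  let t k := ash k.+2 * (bsh k.+2 + bsh k.+1) in
  let r k := ash k.+3 + bsh k.+2 ^+ 2 + ash k.+2 in
  ash k.+3 * t k.+2 + t k.+1 * (r k.+1 + r k) + ash k.+3 * t k.

Lemma quartic_offdiag (k : nat) :
  u ('X^4 * (Psh k.+3 * Psh k.+2)) = offdiag_coef k * hsh k.+2.
Proof.
rewrite (_ : _ * _ = 'X^2 * Psh k.+3 * ('X^2 * Psh k.+2)); last by ring.
rewrite mulX2_succ_sum [X in _ * X]mulX2_sum mulrDl uD functional_dot5.
rewrite [X in X + _](_ : _ = 0) ?add0r.
  rewrite !big_ord_recl big_ord0 !(tnth_nth 0)/= /bump/= !addnS addn0.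
  rewrite -(hsh_rec (j := k.+3))// -(hsh_rec (j := k.+2))// /offdiag_coef.
  apply: subr0_eq; transitivity (ash k.+3 * (bsh k.+2 + bsh k.+1)
    * (ash k.+2 ^+ 2 * hsh k.+1 - ash k.+2 * hsh k.+2)); first by ring.
  by rewrite hsh_rec_sqr// subrr mulr0.
rewrite mulr_sumr (big_morph u uD u0) big1// => i _.
rewrite -scalerAr uZ Psh_orth ?mulr0//.
have -> : k.+1.+4 = (k + 5)%N by rewrite !addnS addn0.
by rewrite eqn_add2l eq_sym ltn_eqF.
Qed.

Lemma pearson_diag (n : nat) :
  4 * z * (ash n.+4 * ash n.+3 + ash n.+3 * (bsh n.+3 + bsh n.+2) ^+ 2
   + (ash n.+3 + bsh n.+2 ^+ 2 + ash n.+2) ^+ 2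
   + ash n.+2 * (bsh n.+2 + bsh n.+1) ^+ 2 + ash n.+2 * ash n.+1) = 2 * n%:R + 1.
Proof.
have h0 : hsh n.+2 != 0 := h_neq0 n.
apply: (mulIf h0); rewrite -(mulrA (4 * z)) -(quartic_diag n) -pearson.
rewrite /hsh /Psh !derivM derivX.
rewrite (_ : _ + _ = P n * P n + 2 *: ('X * (P n)^`() * P n)).
  by rewrite uD uZ functional_mulX_deriv; ring.
by rewrite -mul_polyC rmorph_nat; ring.
Qed.

Lemma pearson_offdiag (n : nat) : 4 * z * offdiag_coef n = - (P n.+1)`_n.
Proof.
have [_ Psize Porth] := P_orth.
have h0 : hsh n.+2 != 0 := h_neq0 n.
apply: (mulIf h0); rewrite -(mulrA (4 * z)) -(quartic_offdiag n) -pearson.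
rewrite /hsh /Psh !derivM derivX.
(* The first term vanishes by orthogonality and the last by degree, so only the middle one
   contributes. *)
rewrite (_ : _ + _ = P n.+1 * P n + 'X * (P n.+1)^`() * P n
    + P n.+1 * ('X * (P n)^`())); last by ring.
rewrite !uD functional_mulX_deriv_succ (functional_lower (size_mulX_deriv n)).
by rewrite (Porth n.+1 n) ?add0r ?addr0//; move/eqP; rewrite eqn_leq ltnn.
Qed.

Lemma subleading_rec (n : nat) : (P n.+2)`_n.+1 = (P n.+1)`_n - b n.+1.
Proof.
have [_ Psize _] := P_orth; have [_ _ rec] := ab_rec.
have := congr1 (fun p : {poly R} => p`_n.+1) (rec n.+1).
rewrite coefXM /= !coefD !coefZ orthogonal_lead_coef [(P n)`_n.+1]nth_default ?Psize//.
by lra.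
Qed.

Lemma subleading1 : (P 1)`_0 = - b 0.
Proof.
have [_ _ rec] := ab_rec.
have := congr1 (fun p : {poly R} => p`_0) (rec 0%N).
by rewrite coefXM /= !coefD !coefZ orthogonal_lead_coef coef0; lra.
Qed.

End OrthogonalPolynomials.

(** * The two identities for the quartic weight *)

Theorem theorem4p1 (R : realType) (z : R) (z_gt0 : 0 < z)
    (P : nat -> {poly R}) (a b : int -> R)
    (P_orth : monic_orthogonal_polys (quartic_functional z) P)
    (ab_rec : recurrence_coefs P a b) :
  let r := Rcoef a b in
  let t := Tcoef a b in
  forall k : nat, let n : int := k%:Z in
    4 * z * (a (n + 2) * a (n + 1) + t (n + 1) * (b (n + 1) + b n)
             + r n ^+ 2 + t n * (b n + b (n - 1)) + a n * a (n - 1))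
      = 2 * k%:R + 1
    /\
    4 * z * (a (n + 1) * (t (n + 2) + t n) - a n * (t (n + 1) + t (n - 1))
             - t n * (r n + r (n - 1)) + t (n + 1) * (r (n + 1) + r n))
      = b n.
Proof.
move=> r t k n.
have uD := quartic_functionalD z_gt0; have uZ := quartic_functionalZ z_gt0.
have h_neq0 m : quartic_functional z (P m * P m) != 0.
  have [_ Psize _] := P_orth.
  by rewrite (quartic_functional_sqr_neq0 z_gt0)// -size_poly_eq0 Psize.
have pearson q : quartic_functional z ('X * q)^`()
    = 4 * z * quartic_functional z ('X^4 * q).
  (* The factor ['X] makes the boundary term at 0 vanish. *)
  have := integral_deriv_poly_weight z_gt0 ('X * q).
  rewrite -scaleNr uD uZ hornerM hornerX mul0r oppr0 mulrA -exprSr => E.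
  by apply: subr0_eq; rewrite -[RHS]E mulNr.
have aE (i : int) (j : nat) : i + 2 = j -> a i = ash a j.
  by move=> ij; rewrite /ash -ij addrK.
have bE (i : int) (j : nat) : i + 2 = j -> b i = bsh b j.
  by move=> ij; rewrite /bsh -ij addrK.
have diag := pearson_diag uD uZ P_orth ab_rec pearson h_neq0.
have offdiag := pearson_offdiag uD uZ P_orth ab_rec pearson h_neq0.
rewrite /r /t /Rcoef /Tcoef /n {r t n}.
rewrite (aE (k%:Z + 2) k.+4) ?(aE (k%:Z + 1) k.+3) ?(aE k%:Z k.+2)
  ?(aE (k%:Z - 1) k.+1) ?(aE (k%:Z + 1 + 1) k.+4) ?(aE (k%:Z - 1 + 1) k.+2);
  try lia.
rewrite (bE (k%:Z + 2) k.+4) ?(bE (k%:Z + 2 - 1) k.+3) ?(bE (k%:Z + 1) k.+3)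
  ?(bE (k%:Z + 1 - 1) k.+2) ?(bE k%:Z k.+2) ?(bE (k%:Z - 1) k.+1)
  ?(bE (k%:Z - 1 - 1) k); try lia.
split; first by rewrite -diag; ring.
(* At [n = 0] there is no preceding relation to subtract: [a_0 = 0] removes the subtracted terms,
   and the subleading coefficient of [P 1] is already [- b 0]. *)
case: k => [|k].
  transitivity (4 * z * offdiag_coef a b 0).
    by rewrite /offdiag_coef (ash_low ab_rec (leqnn 2)); ring.
  by rewrite offdiag (subleading1 P_orth ab_rec) opprK.
transitivity (4 * z * offdiag_coef a b k.+1 - 4 * z * offdiag_coef a b k).
  by rewrite /offdiag_coef; ring.
rewrite !offdiag (subleading_rec P_orth ab_rec) /bsh -[k.+3]addn2 PoszD addrK.
by ring.
Qed.
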